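(* The following data form a bicategory: the 0-cells are all categories; for categories $\mathcal{C},\mathcal{D}$ the hom-category is the category $[\![\mathcal{C},\mathcal{D}]\!]$ whose objects are the open functors from $\mathcal{C}$ to $\mathcal{D}$ and whose arrows are the open natural transformations, with composition the open vertical composition $\bullet$ and identities the identity open natural transformations $\iota[F]$; the identity 1-cell of $\mathcal{C}$ is the identity open functor $\mathrm{Id}[\mathcal{C}]$; the composition functors $[\![\mathcal{D},\mathcal{E}]\!]\times[\![\mathcal{C},\mathcal{D}]\!]\to[\![\mathcal{C},\mathcal{E}]\!]$ are given by composition of open functors and open horizontal composition $\circ$ of open natural transformations; the left unitors are $\mathsf{lu}[F]:\mathrm{Id}[\mathcal{D}]\circ F\Rightarrow F$, the right unitors are $\mathsf{ru}[F]:F\circ\mathrm{Id}[\mathcal{C}]\Rightarrow F$, and the associators are $\mathsf{a}[F,G,H]:H\circ(G\circ F)\Rightarrow(H\circ G)\circ F$, all as defined in the context. That is: each $[\![\mathcal{C},\mathcal{D}]\!]$ is a category, the compositions are functors, $\mathsf{lu},\mathsf{ru},\mathsf{a}$ are natural isomorphisms, and the following coherence conditions hold. Pentagon: for all categories $\mathcal{A},\mathcal{B},\mathcal{C},\mathcal{D},\mathcal{E}$ and all open functors $F$ from $\mathcal{A}$ to $\mathcal{B}$, $G$ from $\mathcal{B}$ to $\mathcal{C}$, $H$ from $\mathcal{C}$ to $\mathcal{D}$, $I$ from $\mathcal{D}$ to $\mathcal{E}$, $$(\mathsf{a}[G,H,I]\circ\iota[F])\bullet\mathsf{a}[F,H\circ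 G,I]\bullet(\iota[I]\circ\mathsf{a}[F,G,H])=\mathsf{a}[F,G,I\circ H]\bullet\mathsf{a}[G\circ F,H,I].$$ Triangle: for all categories $\mathcal{B},\mathcal{C},\mathcal{D}$ and all open functors $F$ from $\mathcal{B}$ to $\mathcal{C}$ and $G$ from $\mathcal{C}$ to $\mathcal{D}$, $$(\mathsf{ru}[G]\circ\iota[F])\bullet\mathsf{a}[F,\mathrm{Id}[\mathcal{C}],G]=\iota[G]\circ\mathsf{lu}[F].$$
   Context: Size issues are disregarded. Notation. Composition of arrows in a category is $g\cdot f$. For an ordinary natural transformation $\theta:F\Rightarrow G:\mathcal{C}\to\mathcal{D}$ the component at $c$ is $\theta[c]$, and for an arrow $f:c\to c'$ the arrow component is $\theta[f]:=G(f)\cdot\theta[c]=\theta[c']\cdot F(f):F(c)\to G(c')$. For ordinary natural transformations, $\bullet$ is vertical and $\circ$ is horizontal composition, so $(\phi\circ\theta)[c]=\phi[\theta[c]]$; $\iota[F]$ is the identity natural transformation of $F$. An arrow $f:Y\to X$ of $\mathrm{Set}^{\mathrm{op}}$ has underlying function $f^{\mathrm{po}}:X\to Y$. Category of elements. For a functor $P:\mathcal{C}\to\mathrm{Set}^{\mathrm{op}}$, the category $\int P$ has objects $(c,x)$ with $c\in\mathcal{C}$, $x\in P(c)$, and arrows $(f,x'):(c,P(f)^{\mathrm{po}}(x'))\to(c',x')$ for $f:c\to c'$ and $x'\in P(c')$, with $(g,x'')\cdot(f,x')=(g\cdot f,x'')$ and identities $(\mathrm{id}[c],x)$. For $\theta:P\Rightarrow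 Q:\mathcal{C}\to\mathrm{Set}^{\mathrm{op}}$, the functor $(\int\theta)^{\mathrm{po}}:\int Q\to\int P$ is $(c,y)\mapsto(c,\theta[c]^{\mathrm{po}}(y))$, $(f,y')\mapsto(f,\theta[c']^{\mathrm{po}}(y'))$ for $f:c\to c'$. Open functor. An open functor $F$ from $\mathcal{C}$ to $\mathcal{D}$ is a pair of functors $F_\alpha:\mathcal{C}\to\mathrm{Set}^{\mathrm{op}}$ and $F_\beta:\int F_\alpha\to\mathcal{D}$. Identity open functor. $\mathrm{Id}[\mathcal{C}]_\alpha$ is constant at the singleton $\{\star\}$ (all arrows sent to the identity), and $\mathrm{Id}[\mathcal{C}]_\beta(c,\star)=c$, $\mathrm{Id}[\mathcal{C}]_\beta(f,\star)=f$. Composition of open functors. For $F$ from $\mathcal{C}$ to $\mathcal{D}$ and $G$ from $\mathcal{D}$ to $\mathcal{E}$, the open functor $G\circ F$ from $\mathcal{C}$ to $\mathcal{E}$ is given, for $c\in\mathcal{C}$ and $f:c\to c'$, by $(G\circ F)_\alpha(c)=\coprod_{x\in F_\alpha(c)}G_\alpha(F_\beta(c,x))$ (elements written $\langle x,y\rangle$), $(G\circ F)_\alpha(f)^{\mathrm{po}}(\langle x',y'\rangle)=\langle F_\alpha(f)^{\mathrm{po}}(x'),G_\alpha(F_\beta(f,x'))^{\mathrm{po}}(y')\rangle$, $(G\circ F)_\beta(c,\langle x,y\rangle)=G_\beta(F_\beta(c,x),y)$, $(G\circ F)_\beta(f,\langle x',y'\rangle)=G_\beta(F_\beta(f,x'),y')$.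 Open natural transformation. For open functors $F,G$ from $\mathcal{C}$ to $\mathcal{D}$, an open natural transformation $\theta:F\Rightarrow G$ is a pair of natural transformations $\theta_\alpha:F_\alpha\Rightarrow G_\alpha:\mathcal{C}\to\mathrm{Set}^{\mathrm{op}}$ and $\theta_\beta:F_\beta\circ(\int\theta_\alpha)^{\mathrm{po}}\Rightarrow G_\beta:\int G_\alpha\to\mathcal{D}$. Identity: $\iota[F]_\alpha=\iota[F_\alpha]$, $\iota[F]_\beta=\iota[F_\beta]$. Open vertical composition. For $\theta:F\Rightarrow G$ and $\phi:G\Rightarrow H$: $(\phi\bullet\theta)_\alpha=\phi_\alpha\bullet\theta_\alpha$ and $(\phi\bullet\theta)_\beta=\phi_\beta\bullet(\theta_\beta\circ\iota[(\int\phi_\alpha)^{\mathrm{po}}])$. Open horizontal composition. For $\theta:F\Rightarrow F'$ (open functors from $\mathcal{C}$ to $\mathcal{D}$) and $\phi:G\Rightarrow G'$ (open functors from $\mathcal{D}$ to $\mathcal{E}$), $\phi\circ\theta:G\circ F\Rightarrow G'\circ F'$ is given by $(\phi\circ\theta)_\alpha[c]^{\mathrm{po}}(\langle x',y'\rangle)=\langle\theta_\alpha[c]^{\mathrm{po}}(x'),\phi_\alpha[\theta_\beta[c,x']]^{\mathrm{po}}(y')\rangle$ and $(\phi\circ\theta)_\beta[c,\langle x',y'\rangle]=\phi_\beta[\theta_\beta[c,x'],y']$, the latter being the arrow component of $\phi_\beta$ at the arrow $(\theta_\beta[c,x'],y')$ of $\int G'_\alpha$. Unitors. For $F$ from $\mathcal{C}$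 to $\mathcal{D}$: $\mathsf{lu}[F]:\mathrm{Id}[\mathcal{D}]\circ F\Rightarrow F$ is given by $\mathsf{lu}[F]_\alpha[c]^{\mathrm{po}}(x)=\langle x,\star\rangle$, $\mathsf{lu}[F]_\beta[c,x]=\mathrm{id}[F_\beta(c,x)]$; $\mathsf{ru}[F]:F\circ\mathrm{Id}[\mathcal{C}]\Rightarrow F$ is given by $\mathsf{ru}[F]_\alpha[c]^{\mathrm{po}}(x)=\langle\star,x\rangle$, $\mathsf{ru}[F]_\beta[c,x]=\mathrm{id}[F_\beta(c,x)]$. Associator. For $F$ from $\mathcal{B}$ to $\mathcal{C}$, $G$ from $\mathcal{C}$ to $\mathcal{D}$, $H$ from $\mathcal{D}$ to $\mathcal{E}$: $\mathsf{a}[F,G,H]:H\circ(G\circ F)\Rightarrow(H\circ G)\circ F$ is given by $\mathsf{a}[F,G,H]_\alpha[b]^{\mathrm{po}}(\langle x,\langle y,z\rangle\rangle)=\langle\langle x,y\rangle,z\rangle$ and $\mathsf{a}[F,G,H]_\beta[b,\langle x,\langle y,z\rangle\rangle]=\mathrm{id}[H_\beta(G_\beta(F_\beta(b,x),y),z)]$. *)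

(* Defs.v *)
(* Plain Rocq with the Stdlib axioms of function extensionality and proof
   irrelevance.  Equality of arrows is Leibniz equality. *)
From Stdlib Require Import ssreflect FunctionalExtensionality ProofIrrelevance.

Set Implicit Arguments.
Unset Strict Implicit.
Unset Printing Implicit Defensive.

(* Data and laws are kept apart, so that "these data form a category (a
   functor, a bicategory)" is a proposition. *)

Record cat_data := CatData {
  ob :> Type;
  hom : ob -> ob -> Type;
  idc : forall c, hom c c;
  comp : forall a b c, hom b c -> hom a b -> hom a c }.

Arguments hom {c} _ _ : rename.
Arguments idc {c} _ : rename.
Arguments comp {c} {_ _ _} _ _ : rename.

Notation "g · f" := (comp g f) (at level 40, left associativity).

Record is_category (C : cat_data) : Prop := IsCategory {
  comp_id_l : forall (a b : C) (f : hom a b), idc b · f = f;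
  comp_id_r : forall (a b : C) (f : hom a b), f · idc a = f;
  comp_assoc : forall (a b c d : C) (h : hom c d) (g : hom b c) (f : hom a b),
    h · (g · f) = (h · g) · f }.

Record category := Category {
  cdata :> cat_data;
  claws : is_category cdata }.

Definition is_iso (C : cat_data) (a b : C) (f : hom a b) : Prop :=
  exists g : hom b a, g · f = idc a /\ f · g = idc b.

Record functor_data (C D : cat_data) := FunctorData {
  fob :> C -> D;
  fmap : forall a b : C, hom a b -> hom (fob a) (fob b) }.

Arguments fmap {C D} _ {a b} _.

Record is_functor (C D : cat_data) (F : functor_data C D) : Prop := IsFunctor {
  fmap_id : forall a : C, fmap F (idc a) = idc (F a);
  fmap_comp : forall (a b c : C) (g : hom b c) (f : hom a b),
    fmap F (g · f) = fmap F g · fmap F f }.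

Record functor (C D : cat_data) := Functor {
  fdata :> functor_data C D;
  flaws : is_functor fdata }.

Definition fcomp_data (C D E : cat_data)
    (G : functor_data D E) (F : functor_data C D) : functor_data C E :=
  FunctorData (fun a b f => fmap G (fmap F (a:=a) (b:=b) f)).

Lemma fcomp_laws (C D E : cat_data) (G : functor D E) (F : functor C D) :
  is_functor (fcomp_data G F).
Proof.
split=> [a|a b c g f] /=.
  by rewrite (fmap_id (flaws F)) (fmap_id (flaws G)).
by rewrite (fmap_comp (flaws F)) (fmap_comp (flaws G)).
Qed.

Definition fcomp (C D E : cat_data) (G : functor D E) (F : functor C D) :
  functor C E := Functor (fcomp_laws G F).

Record nat_trans (C D : cat_data) (F G : functor C D) := NatTrans {
  cmp :> forall c : C, hom (F c) (G c);
  cmp_nat : forall (c c' : C) (f : hom c c'),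
    fmap G f · cmp c = cmp c' · fmap F f }.

(* The arrow component θ[f]. *)
Definition arr_cmp (C D : cat_data) (F G : functor C D) (theta : nat_trans F G)
    (c c' : C) (f : hom c c') : hom (F c) (G c') :=
  fmap G f · theta c.

Lemma nt_id_nat (C : cat_data) (D : category) (F : functor C D)
    (c c' : C) (f : hom c c') :
  fmap F f · idc (F c) = idc (F c') · fmap F f.
Proof. by rewrite (comp_id_l (claws D)) (comp_id_r (claws D)). Qed.

Definition nt_id (C : cat_data) (D : category) (F : functor C D) :
  nat_trans F F := NatTrans (@nt_id_nat C D F).

Lemma nt_comp_nat (C : cat_data) (D : category) (F G H : functor C D)
    (phi : nat_trans G H) (theta : nat_trans F G) (c c' : C) (f : hom c c') :
  fmap H f · (phi c · theta c) = (phi c' · theta c') · fmap F f.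
Proof.
by rewrite (comp_assoc (claws D)) cmp_nat -!(comp_assoc (claws D)) cmp_nat.
Qed.

Definition nt_comp (C : cat_data) (D : category) (F G H : functor C D)
    (phi : nat_trans G H) (theta : nat_trans F G) : nat_trans F H :=
  NatTrans (nt_comp_nat phi theta).

Definition prod_cat_data (C D : cat_data) : cat_data := {|
  ob := C * D;
  hom x y := (hom (fst x) (fst y) * hom (snd x) (snd y))%type;
  idc x := (idc (fst x), idc (snd x));
  comp _ _ _ g f := (fst g · fst f, snd g · snd f) |}.

(* Horizontal composition is written in applicative order: [bcomp] sends
   (G, F) to G∘F.  The unitors and associators point towards the composites
   F, F and (H∘G)∘F respectively. *)

Record bicat_data := BicatData {
  b0 :> Type;
  bhom : b0 -> b0 -> cat_data;
  bid : forall a, bhom a a;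
  bcomp : forall a b c,
    functor_data (prod_cat_data (bhom b c) (bhom a b)) (bhom a c);
  blu : forall a b (F : bhom a b), hom (bcomp a b b (bid b, F)) F;
  bru : forall a b (F : bhom a b), hom (bcomp a a b (F, bid a)) F;
  bas : forall a b c d (F : bhom a b) (G : bhom b c) (H : bhom c d),
    hom (bcomp a c d (H, bcomp a b c (G, F)))
        (bcomp a b d (bcomp b c d (H, G), F)) }.

Arguments bhom {_} _ _.
Arguments bid {_} _.
Arguments bcomp {_ _ _ _}.
Arguments blu {_ _ _} _.
Arguments bru {_ _ _} _.
Arguments bas {_ _ _ _ _} _ _ _.

Definition bcomp1 (B : bicat_data) (a b c : B) (G : bhom b c) (F : bhom a b) :
  bhom a c := bcomp (G, F).

Definition bcomp2 (B : bicat_data) (a b c : B) (G G' : bhom b c)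
    (F F' : bhom a b) (phi : hom G G') (theta : hom F F') :
    hom (bcomp1 G F) (bcomp1 G' F') :=
  fmap bcomp (a := (G, F)) (b := (G', F')) (phi, theta).

Record is_bicategory (B : bicat_data) : Prop := IsBicategory {
  bhom_category : forall a b : B, is_category (bhom a b);
  bcomp_functor : forall a b c : B, is_functor (@bcomp B a b c);
  blu_iso : forall (a b : B) (F : bhom a b), is_iso (blu F);
  blu_natural : forall (a b : B) (F F' : bhom a b) (theta : hom F F'),
    theta · blu F = blu F' · bcomp2 (idc (bid b)) theta;
  bru_iso : forall (a b : B) (F : bhom a b), is_iso (bru F);
  bru_natural : forall (a b : B) (F F' : bhom a b) (theta : hom F F'),
    theta · bru F = bru F' · bcomp2 theta (idc (bid a));
  bas_iso : forall (a b c d : B)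
      (F : bhom a b) (G : bhom b c) (H : bhom c d), is_iso (bas F G H);
  bas_natural : forall (a b c d : B)
      (F F' : bhom a b) (G G' : bhom b c) (H H' : bhom c d)
      (theta : hom F F') (phi : hom G G') (psi : hom H H'),
    bcomp2 (bcomp2 psi phi) theta · bas F G H
      = bas F' G' H' · bcomp2 psi (bcomp2 phi theta);
  bpentagon : forall (a b c d e : B)
      (F : bhom a b) (G : bhom b c) (H : bhom c d) (I : bhom d e),
    bcomp2 (bas G H I) (idc F) · bas F (bcomp1 H G) I
        · bcomp2 (idc I) (bas F G H)
      = bas F G (bcomp1 I H) · bas (bcomp1 G F) H I;
  btriangle : forall (b c d : B) (F : bhom b c) (G : bhom c d),
    bcomp2 (bru G) (idc F) · bas F (bid c) G = bcomp2 (idc G) (blu F) }.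

(* An arrow from Y to X is a function from X to Y.  Universe inference puts the
   sets one level below the objects and arrows of the categories. *)
Definition setop_data : cat_data := {|
  ob := Type;
  hom Y X := X -> Y;
  idc X := fun x => x;
  comp _ _ _ g f := fun x => f (g x) |}.

Lemma setop_laws : is_category setop_data.
Proof. by split. Qed.

Definition SetOp : category := Category setop_laws.

(* The underlying function f^po : X -> Y of f : Y -> X. *)
Definition po (Y X : SetOp) (f : hom Y X) : X -> Y := f.

Lemma po_fmap_id (C : cat_data) (P : functor C SetOp) (c : C) (x : P c) :
  po (fmap P (idc c)) x = x.
Proof. by rewrite (fmap_id (flaws P)). Qed.

Lemma po_fmap_comp (C : cat_data) (P : functor C SetOp) (a b c : C)
    (g : hom b c) (f : hom a b) (x : P c) :
  po (fmap P (g · f)) x = po (fmap P f) (po (fmap P g) x).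
Proof. by rewrite (fmap_comp (flaws P)). Qed.

Lemma po_nat (C : cat_data) (P Q : functor C SetOp) (theta : nat_trans P Q)
    (c c' : C) (f : hom c c') (y : Q c') :
  po (fmap P f) (po (theta c') y) = po (theta c) (po (fmap Q f) y).
Proof. exact: (eq_sym (equal_f (cmp_nat theta f) y)). Qed.

Set Primitive Projections.
Record elt (C : cat_data) (P : functor C SetOp) := Elt {
  elt_ob : C;
  elt_pt : P elt_ob }.
Unset Primitive Projections.

Arguments Elt {C} P _ _.

(* Arrows from (c, x) to (c', x') are the arrows f : c -> c' such that
   P(f)^po(x') = x: the pair (f, x') has exactly this one source. *)
Definition elt_hom (C : cat_data) (P : functor C SetOp) (o o' : elt P) :=
  {f : hom (elt_ob o) (elt_ob o') | po (fmap P f) (elt_pt o') = elt_pt o}.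

Lemma elt_hom_eq (C : cat_data) (P : functor C SetOp) (o o' : elt P)
  (u v : elt_hom o o') : proj1_sig u = proj1_sig v -> u = v.
Proof.
by case: u v => [f p] [g q] /= e; case: g / e q => q;
   rewrite (proof_irrelevance _ p q).
Qed.

Lemma elt_comp_proof (C : cat_data) (P : functor C SetOp) (o1 o2 o3 : elt P)
    (v : elt_hom o2 o3) (u : elt_hom o1 o2) :
  po (fmap P (proj1_sig v · proj1_sig u)) (elt_pt o3) = elt_pt o1.
Proof. by rewrite po_fmap_comp (proj2_sig v) (proj2_sig u). Qed.

Definition elts_data (C : cat_data) (P : functor C SetOp) : cat_data := {|
  ob := elt P;
  hom := @elt_hom C P;
  idc o := exist _ (idc (elt_ob o)) (po_fmap_id (elt_pt o));
  comp _ _ _ v u := exist _ (proj1_sig v · proj1_sig u) (elt_comp_proof v u) |}.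

Lemma elts_laws (C : category) (P : functor C SetOp) :
  is_category (elts_data P).
Proof.
split=> *; apply: elt_hom_eq => /=.
- exact: (comp_id_l (claws C)).
- exact: (comp_id_r (claws C)).
- exact: (comp_assoc (claws C)).
Qed.

Definition elts (C : category) (P : functor C SetOp) : category :=
  Category (elts_laws P).

(* The arrow (f, x') : (c, P(f)^po(x')) -> (c', x'). *)
Definition earr (C : category) (P : functor C SetOp) (c c' : C) (f : hom c c')
    (x' : P c') :
    @hom (elts P) (Elt P c (po (fmap P f) x')) (Elt P c' x') :=
  exist _ f eq_refl.

(* Every arrow of ∫P is of the form (f, x'). *)
Lemma earr_ind (C : category) (P : functor C SetOp) (c c' : C) (x' : P c')
    (K : forall x : P c, @hom (elts P) (Elt P c x) (Elt P c' x') -> Prop) :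
  (forall f : hom c c', K _ (earr f x')) -> forall x u, K x u.
Proof.
move=> KP x [f e].
exact: (match e as e0 in _ = x0 return K x0 (exist _ f e0) with
        | eq_refl => KP f end).
Qed.

Lemma elts_map_proof (C : category) (P Q : functor C SetOp)
    (theta : nat_trans P Q) (o o' : elts Q) (u : hom o o') :
  po (fmap P (proj1_sig u)) (po (theta (elt_ob o')) (elt_pt o'))
    = po (theta (elt_ob o)) (elt_pt o).
Proof. by rewrite po_nat (proj2_sig u). Qed.

(* The functor (∫θ)^po : ∫Q -> ∫P. *)
Definition elts_map_data (C : category) (P Q : functor C SetOp)
    (theta : nat_trans P Q) : functor_data (elts Q) (elts P) := {|
  fob := fun o : elts Q =>
    Elt P (elt_ob o) (po (theta (elt_ob o)) (elt_pt o)) : elts P;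
  fmap := fun (o o' : elts Q) (u : hom o o') =>
    exist _ (proj1_sig u) (elts_map_proof theta u) |}.

Lemma elts_map_laws (C : category) (P Q : functor C SetOp)
  (theta : nat_trans P Q) : is_functor (elts_map_data theta).
Proof. by split=> *; apply: elt_hom_eq. Qed.

Definition elts_map (C : category) (P Q : functor C SetOp)
  (theta : nat_trans P Q) : functor (elts Q) (elts P) :=
  Functor (elts_map_laws theta).

Record open_functor (C D : category) := OpenFunctor {
  oalpha : functor C SetOp;
  obeta : functor (elts oalpha) D }.

(* F_β(c, x) *)
Notation "F @[ c , x ]" := (obeta F (Elt (oalpha F) c x))
  (at level 9, c at level 99, x at level 99, format "F @[ c ,  x ]").

Definition oid_alpha_data (C : category) : functor_data C SetOp := {|
  fob := fun _ => unit : SetOp;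
  fmap := fun _ _ _ => idc (unit : SetOp) |}.

Lemma oid_alpha_laws (C : category) : is_functor (oid_alpha_data C).
Proof. by split. Qed.

Definition oid_alpha (C : category) : functor C SetOp :=
  Functor (oid_alpha_laws C).

Definition oid_beta_data (C : category) :
    functor_data (elts (oid_alpha C)) C := {|
  fob := fun o : elts (oid_alpha C) => elt_ob o;
  fmap := fun (o o' : elts (oid_alpha C)) (u : hom o o') => proj1_sig u |}.

Lemma oid_beta_laws (C : category) : is_functor (oid_beta_data C).
Proof. by split. Qed.

Definition oid (C : category) : open_functor C C :=
  OpenFunctor (Functor (oid_beta_laws C)).

Section OpenComp.
Variables (C D E : category) (G : open_functor D E) (F : open_functor C D).

Definition ocomp_alpha_ob (c : C) : SetOp :=
  {x : oalpha F c & oalpha G F@[c, x]}.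

(* Transport of elements of the coproduct along the arrow (f, x') of ∫F_α. *)
Definition ocomp_alpha_map (c c' : C) (f : hom c c') (w : ocomp_alpha_ob c') :
    ocomp_alpha_ob c :=
  existT _ (po (fmap (oalpha F) f) (projT1 w))
           (po (fmap (oalpha G) (fmap (obeta F) (earr f (projT1 w))))
               (projT2 w)).

Definition ocomp_alpha_data : functor_data C SetOp := {|
  fob := ocomp_alpha_ob;
  fmap := ocomp_alpha_map : forall c c' : C,
    hom c c' -> @hom SetOp (ocomp_alpha_ob c) (ocomp_alpha_ob c') |}.

(* The pair (f, x') may be replaced by any arrow u of ∫F_α equal to it. *)
Lemma ocomp_alpha_src (c c' : C) (x : oalpha F c) (x' : oalpha F c')
    (u : @hom (elts (oalpha F)) (Elt _ c x) (Elt _ c' x'))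
    (y : oalpha G F@[c', x']) :
  ocomp_alpha_map (proj1_sig u) (existT _ x' y)
    = existT _ x (po (fmap (oalpha G) (fmap (obeta F) u)) y).
Proof.
by move: x u; apply: earr_ind.
Qed.

Lemma ocomp_alpha_laws : is_functor ocomp_alpha_data.
Proof.
split=> [c|a b c g f]; apply: functional_extensionality => -[x y].
- apply: eq_trans (ocomp_alpha_src (@idc (elts (oalpha F)) (Elt _ c x)) y) _.
  by rewrite (fmap_id (flaws (obeta F))) po_fmap_id.
- apply: eq_trans (ocomp_alpha_src (earr g x · earr f _) y) _.
  by rewrite (fmap_comp (flaws (obeta F))) po_fmap_comp.
Qed.

Definition ocomp_alpha : functor C SetOp := Functor ocomp_alpha_laws.

(* The two parts of an arrow (f, <x', y'>) of ∫(G∘F)_α: first (f, x'), then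
   (F_β(f, x'), y'). *)
Definition ocomp_fst_arr (o o' : elts ocomp_alpha) (u : hom o o') :
    @hom (elts (oalpha F)) (Elt _ (elt_ob o) (projT1 (elt_pt o)))
                           (Elt _ (elt_ob o') (projT1 (elt_pt o'))) :=
  exist _ (proj1_sig u) (f_equal (@projT1 _ _) (proj2_sig u)).

Lemma ocomp_snd_proof (o o' : elts ocomp_alpha) (u : hom o o') :
  po (fmap (oalpha G) (fmap (obeta F) (ocomp_fst_arr u))) (projT2 (elt_pt o'))
    = projT2 (elt_pt o).
Proof.
by case: o u => c w; case: o' => c' w'; move: w; apply: earr_ind.
Qed.

Definition ocomp_snd_arr (o o' : elts ocomp_alpha) (u : hom o o') :
    @hom (elts (oalpha G))
      (Elt _ F@[elt_ob o, projT1 (elt_pt o)] (projT2 (elt_pt o)))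
      (Elt _ F@[elt_ob o', projT1 (elt_pt o')] (projT2 (elt_pt o'))) :=
  exist _ (fmap (obeta F) (ocomp_fst_arr u)) (ocomp_snd_proof u).

Definition ocomp_beta_data : functor_data (elts ocomp_alpha) E := {|
  fob := fun o : elts ocomp_alpha =>
    G@[F@[elt_ob o, projT1 (elt_pt o)], projT2 (elt_pt o)];
  fmap := fun (o o' : elts ocomp_alpha) (u : hom o o') =>
    fmap (obeta G) (ocomp_snd_arr u) |}.

Lemma ocomp_beta_laws : is_functor ocomp_beta_data.
Proof.
split=> [o|o1 o2 o3 v u] /=.
- rewrite -(fmap_id (flaws (obeta G))); congr fmap; apply: elt_hom_eq => /=.
  by rewrite -(fmap_id (flaws (obeta F))); congr fmap; apply: elt_hom_eq.
- rewrite -(fmap_comp (flaws (obeta G))); congr fmap; apply: elt_hom_eq => /=.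
  by rewrite -(fmap_comp (flaws (obeta F))); congr fmap; apply: elt_hom_eq.
Qed.

Definition ocomp : open_functor C E :=
  OpenFunctor (Functor ocomp_beta_laws).

(* (G∘F)_β(f, <x', y'>) = G_β(F_β(f, x'), y') *)
Lemma ocomp_beta_earr (c c' : C) (f : hom c c') (x' : oalpha F c')
    (y' : oalpha G F@[c', x']) :
  fmap (obeta ocomp) (earr (P := ocomp_alpha) f (existT _ x' y'))
    = fmap (obeta G) (earr (fmap (obeta F) (earr f x')) y').
Proof. by rewrite /=; congr fmap; apply: elt_hom_eq. Qed.

End OpenComp.

Record open_nat (C D : category) (F G : open_functor C D) := OpenNat {
  nalpha : nat_trans (oalpha F) (oalpha G);
  nbeta : nat_trans (fcomp (obeta F) (elts_map nalpha)) (obeta G) }.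

Section IdVert.
Variables (C D : category).

Lemma onat_id_beta_nat (F : open_functor C D)
    (o o' : elts (oalpha F)) (u : hom o o') :
  fmap (obeta F) u · idc (obeta F o)
    = idc (obeta F o')
        · fmap (fcomp (obeta F) (elts_map (nt_id (oalpha F)))) u.
Proof.
rewrite (comp_id_l (claws D)) (comp_id_r (claws D)) /=.
by congr fmap; apply: elt_hom_eq.
Qed.

(* (∫ι[F_α])^po is the identity on objects by conversion, and on arrows up to
   proof irrelevance, so the components of ι[F_β] can be used as they are. *)
Definition onat_id (F : open_functor C D) : open_nat F F := {|
  nalpha := nt_id (oalpha F);
  nbeta := NatTrans
    (F := fcomp (obeta F) (elts_map (nt_id (oalpha F)))) (G := obeta F)
    (@onat_id_beta_nat F) |}.

(* θ_β∘ι[(∫φ_α)^po] has the component of θ_β at (∫φ_α)^po(o) as its component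
   at o. *)
Variables (F G H : open_functor C D).
Variables (phi : open_nat G H) (theta : open_nat F G).

Lemma onat_comp_beta_nat (o o' : elts (oalpha H)) (u : hom o o') :
  fmap (obeta H) u · (nbeta phi o · nbeta theta (elts_map (nalpha phi) o))
    = (nbeta phi o' · nbeta theta (elts_map (nalpha phi) o'))
        · fmap (fcomp (obeta F)
                  (elts_map (nt_comp (nalpha phi) (nalpha theta)))) u.
Proof.
rewrite (comp_assoc (claws D)) cmp_nat -!(comp_assoc (claws D)).
congr comp; rewrite [LHS]cmp_nat; congr comp.
by rewrite /=; congr fmap; apply: elt_hom_eq.
Qed.

Definition onat_comp : open_nat F H := {|
  nalpha := nt_comp (nalpha phi) (nalpha theta);
  nbeta := NatTrans
    (F := fcomp (obeta F) (elts_map (nt_comp (nalpha phi) (nalpha theta))))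
    (G := obeta H) onat_comp_beta_nat |}.

End IdVert.

Definition open_hom (C D : category) : cat_data := {|
  ob := open_functor C D;
  hom := @open_nat C D;
  idc := @onat_id C D;
  comp := @onat_comp C D |}.

Section Horizontal.
Variables (C D E : category) (F F' : open_functor C D) (G G' : open_functor D E).
Variables (phi : open_nat G G') (theta : open_nat F F').

Definition hcomp_alpha_cmp (c : C) :
    @hom SetOp (oalpha (ocomp G F) c) (oalpha (ocomp G' F') c) :=
  fun w =>
  existT _ (po (nalpha theta c) (projT1 w))
           (po (arr_cmp (nalpha phi) (nbeta theta (Elt _ c (projT1 w))))
               (projT2 w)).

Arguments hcomp_alpha_cmp : clear implicits.

Lemma hcomp_alpha_nat (c c' : C) (f : hom c c') :
  fmap (oalpha (ocomp G' F')) f · hcomp_alpha_cmp c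
    = hcomp_alpha_cmp c' · fmap (oalpha (ocomp G F)) f.
Proof.
apply: functional_extensionality => -[x' y'] /=.
rewrite /hcomp_alpha_cmp /=.
rewrite -[f in RHS]/(proj1_sig (fmap (elts_map (nalpha theta)) (earr f x'))).
rewrite (ocomp_alpha_src (fmap (elts_map (nalpha theta)) (earr f x'))).
congr existT; rewrite /arr_cmp /= /po /=.
rewrite -![fmap (oalpha G') _ _]/(po (fmap (oalpha G') _) _).
rewrite -![nalpha phi _ _]/(po (nalpha phi _) _).
rewrite -![fmap (oalpha G) _ _]/(po (fmap (oalpha G) _) _).
rewrite po_nat -!po_fmap_comp; congr (po _ (po (fmap _ _) _)).
exact: (cmp_nat (nbeta theta) (earr f x')).
Qed.

Definition hcomp_alpha :
    nat_trans (oalpha (ocomp G F)) (oalpha (ocomp G' F')) :=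
  NatTrans hcomp_alpha_nat.

(* φ_β[θ_β[c, x'], y'] at o = (c, <x', y'>). *)
Definition hcomp_beta_cmp (o : elts (oalpha (ocomp G' F'))) :
    hom (obeta (ocomp G F) (elts_map hcomp_alpha o))
        (obeta (ocomp G' F') o) :=
  arr_cmp (nbeta phi)
    (earr (P := oalpha G')
       (nbeta theta (Elt _ (elt_ob o) (projT1 (elt_pt o))))
       (projT2 (elt_pt o))).

Lemma hcomp_beta_nat (o o' : elts (oalpha (ocomp G' F'))) (u : hom o o') :
  fmap (obeta (ocomp G' F')) u · hcomp_beta_cmp o
    = hcomp_beta_cmp o'
        · fmap (fcomp (obeta (ocomp G F)) (elts_map hcomp_alpha)) u.
Proof.
rewrite /hcomp_beta_cmp /arr_cmp.
set x : elts (oalpha F') := Elt _ (elt_ob o) _.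
set x' : elts (oalpha F') := Elt _ (elt_ob o') _.
set k := earr _ (projT2 (elt_pt o)).
set k' := earr _ (projT2 (elt_pt o')).
pose u1 : hom x x' := ocomp_fst_arr u.
pose u2 := ocomp_snd_arr u.
pose v1 := fmap (fcomp (obeta F) (elts_map (nalpha theta))) u1.
have v1P : po (fmap (oalpha G') v1)
    (po (fmap (oalpha G') (nbeta theta x')) (projT2 (elt_pt o')))
    = po (fmap (oalpha G') (nbeta theta x)) (projT2 (elt_pt o)).
  have /= <- := proj2_sig u2.
  rewrite -/u1 -!po_fmap_comp; congr (po (fmap _ _) _).
  exact: (eq_sym (cmp_nat (nbeta theta) u1)).
pose v : @hom (elts (oalpha G'))
   (Elt _ _ (po (fmap (oalpha G') (nbeta theta x)) (projT2 (elt_pt o))))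
   (Elt _ _ (po (fmap (oalpha G') (nbeta theta x')) (projT2 (elt_pt o'))))
  := exist _ v1 v1P.
have -> : fmap (fcomp (obeta (ocomp G F)) (elts_map hcomp_alpha)) u
    = fmap (fcomp (obeta G) (elts_map (nalpha phi))) v.
  rewrite /=; congr fmap; apply: elt_hom_eq => /=.
  by rewrite /v1; congr fmap; apply: elt_hom_eq.
rewrite -(comp_assoc (claws E)).
have /= <- := cmp_nat (nbeta phi) v.
rewrite !(comp_assoc (claws E)); congr comp.
rewrite -!(fmap_comp (flaws (obeta G'))); congr fmap; apply: elt_hom_eq.
exact: (cmp_nat (nbeta theta) u1).
Qed.

Definition hcomp : open_nat (ocomp G F) (ocomp G' F') :=
  OpenNat (NatTrans
    (F := fcomp (obeta (ocomp G F)) (elts_map hcomp_alpha))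
    (G := obeta (ocomp G' F')) hcomp_beta_nat).

End Horizontal.

Definition open_comp (C D E : category) :
    functor_data (prod_cat_data (open_hom D E) (open_hom C D)) (open_hom C E) :=
  {| fob := fun p : prod_cat_data (open_hom D E) (open_hom C D) =>
       ocomp (fst p) (snd p) : open_hom C E;
     fmap := fun (p q : prod_cat_data (open_hom D E) (open_hom C D))
       (t : hom p q) => hcomp (fst t) (snd t) |}.

Section Unitors.
Variables (C D : category) (F : open_functor C D).

Definition lu_alpha_cmp (c : C) :
    @hom SetOp (oalpha (ocomp (oid D) F) c) (oalpha F c) :=
  fun x => existT _ x tt.

Arguments lu_alpha_cmp : clear implicits.

Lemma lu_alpha_nat (c c' : C) (f : hom c c') :
  fmap (oalpha F) f · lu_alpha_cmp c
    = lu_alpha_cmp c' · fmap (oalpha (ocomp (oid D) F)) f.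
Proof. by []. Qed.

Definition lu_alpha : nat_trans (oalpha (ocomp (oid D) F)) (oalpha F) :=
  NatTrans lu_alpha_nat.

Lemma lu_beta_nat (o o' : elts (oalpha F)) (u : hom o o') :
  fmap (obeta F) u · idc (obeta F o)
    = idc (obeta F o')
        · fmap (fcomp (obeta (ocomp (oid D) F)) (elts_map lu_alpha)) u.
Proof.
rewrite (comp_id_l (claws D)) (comp_id_r (claws D)) /=.
by congr fmap; apply: elt_hom_eq.
Qed.

Definition lu : open_nat (ocomp (oid D) F) F :=
  OpenNat (NatTrans
    (F := fcomp (obeta (ocomp (oid D) F)) (elts_map lu_alpha))
    (G := obeta F) lu_beta_nat).

Definition ru_alpha_cmp (c : C) :
    @hom SetOp (oalpha (ocomp F (oid C)) c) (oalpha F c) :=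
  fun x => existT _ tt x.

Arguments ru_alpha_cmp : clear implicits.

Lemma ru_alpha_nat (c c' : C) (f : hom c c') :
  fmap (oalpha F) f · ru_alpha_cmp c
    = ru_alpha_cmp c' · fmap (oalpha (ocomp F (oid C))) f.
Proof. by []. Qed.

Definition ru_alpha : nat_trans (oalpha (ocomp F (oid C))) (oalpha F) :=
  NatTrans ru_alpha_nat.

Lemma ru_beta_nat (o o' : elts (oalpha F)) (u : hom o o') :
  fmap (obeta F) u · idc (obeta F o)
    = idc (obeta F o')
        · fmap (fcomp (obeta (ocomp F (oid C))) (elts_map ru_alpha)) u.
Proof.
rewrite (comp_id_l (claws D)) (comp_id_r (claws D)) /=.
by congr fmap; apply: elt_hom_eq.
Qed.

Definition ru : open_nat (ocomp F (oid C)) F :=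
  OpenNat (NatTrans
    (F := fcomp (obeta (ocomp F (oid C))) (elts_map ru_alpha))
    (G := obeta F) ru_beta_nat).

End Unitors.

Section Associator.
Variables (B C D E : category).
Variables (F : open_functor B C) (G : open_functor C D) (H : open_functor D E).

(* <x, <y, z>> is sent to <<x, y>, z>. *)
Definition as_alpha_cmp (b : B) :
    @hom SetOp (oalpha (ocomp H (ocomp G F)) b)
               (oalpha (ocomp (ocomp H G) F) b) :=
  fun w =>
  existT _ (existT _ (projT1 w) (projT1 (projT2 w)))
           (projT2 (projT2 w)).

Arguments as_alpha_cmp : clear implicits.

Lemma as_alpha_nat (b b' : B) (f : hom b b') :
  fmap (oalpha (ocomp (ocomp H G) F)) f · as_alpha_cmp b
    = as_alpha_cmp b' · fmap (oalpha (ocomp H (ocomp G F))) f.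
Proof.
apply: functional_extensionality => -[x [y z]] /=.
rewrite /as_alpha_cmp /ocomp_alpha_map /=; congr existT.
by congr (po (fmap (oalpha H) (fmap (obeta G) _)) _); apply: elt_hom_eq.
Qed.

Definition as_alpha :
    nat_trans (oalpha (ocomp H (ocomp G F))) (oalpha (ocomp (ocomp H G) F)) :=
  NatTrans as_alpha_nat.

Lemma as_beta_nat (o o' : elts (oalpha (ocomp (ocomp H G) F))) (u : hom o o') :
  fmap (obeta (ocomp (ocomp H G) F)) u
      · idc (obeta (ocomp (ocomp H G) F) o)
    = idc (obeta (ocomp (ocomp H G) F) o')
      · fmap (fcomp (obeta (ocomp H (ocomp G F))) (elts_map as_alpha)) u.
Proof.
rewrite (comp_id_l (claws E)) (comp_id_r (claws E)) /=.
congr fmap; apply: elt_hom_eq => /=.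
congr fmap; apply: elt_hom_eq => /=.
by congr fmap; apply: elt_hom_eq.
Qed.

Definition assoc : open_nat (ocomp H (ocomp G F)) (ocomp (ocomp H G) F) :=
  OpenNat (NatTrans
    (F := fcomp (obeta (ocomp H (ocomp G F))) (elts_map as_alpha))
    (G := obeta (ocomp (ocomp H G) F)) as_beta_nat).

End Associator.

(* Main.v *)
(* An open natural transformation is determined by its α components and its β
   components, but two β components can only be compared after their sources,
   which depend on α, have been identified.  The identification is made by an
   arrow of ∫F_α lying over an identity of the base category: since arrows of
   ∫F_α are determined by their images in the base category, each coherence
   equation reduces, by functoriality and by the naturality of the β parts
   along such arrows, to an equation between arrows of the base category. *)
Require Import Defs.
From Stdlib Require Import ssreflect FunctionalExtensionality ProofIrrelevance.

Set Implicit Arguments.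
Unset Strict Implicit.
Unset Printing Implicit Defensive.

(** * Equality of open natural transformations *)

Lemma nat_trans_eq (C D : cat_data) (F G : functor C D) (s t : nat_trans F G) :
  (forall c, s c = t c) -> s = t.
Proof.
case: s t => s sP [t tP] /= st.
have {}st : s = t by apply: functional_extensionality_dep.
by case: t / st tP => tP; rewrite (proof_irrelevance _ sP tP).
Qed.

(** Serves when two α parts agree by conversion: the arrow comparing the sources of their β
    components is then an endo-arrow, and this makes it an identity. *)
Lemma elt_arrow_id (C : category) (P : functor C SetOp) (o : elts P)
  (u : hom o o) : proj1_sig u = idc (elt_ob o) -> u = idc o.
Proof. by move=> uE; apply: elt_hom_eq. Qed.

(** Stands in for a cast along [e]: naturality along this arrow moves a β component between points
    that are only provably equal. *)
Definition elt_eq (C : category) (P : functor C SetOp) (c : C) (x x' : P c)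
    (e : x = x') : @hom (elts P) (Elt P c x) (Elt P c x') :=
  exist _ (idc c) (eq_trans (po_fmap_id x') (eq_sym e)).

(* The arrow u can be taken arbitrary over the identity, as any two such arrows
   are equal; keeping it abstract avoids transports along equalities of
   points. *)
Lemma open_nat_eq (C D : category) (F G : open_functor C D)
    (s t : open_nat F G) :
  (forall o : elts (oalpha G),
     po (nalpha s (elt_ob o)) (elt_pt o)
       = po (nalpha t (elt_ob o)) (elt_pt o)) ->
  (forall (o : elts (oalpha G))
     (u : hom (elts_map (nalpha s) o) (elts_map (nalpha t) o)),
     proj1_sig u = idc (elt_ob o) ->
     nbeta s o = nbeta t o · fmap (obeta F) u) ->
  s = t.
Proof.
case: s t => sa sb [ta tb] /= stA.
have {}stA : sa = ta.
  apply: nat_trans_eq => c; apply: functional_extensionality => x.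
  exact: (stA (Elt _ c x)).
case: ta / stA tb => tb stB; congr OpenNat.
apply: nat_trans_eq => o.
rewrite (stB o (idc (elts_map sa o))) //.
by rewrite (fmap_id (flaws (obeta F))) (comp_id_r (claws D)).
Qed.

(** * Hom-categories *)

Lemma open_hom_laws (C D : category) : is_category (open_hom C D).
Proof.
split.
- move=> F G s; apply: open_nat_eq => // o u /= /(elt_arrow_id (u := u)) ->.
  rewrite (fmap_id (flaws (obeta F))).
  by rewrite (comp_id_r (claws D)) (comp_id_l (claws D)).
- move=> F G s; apply: open_nat_eq => // o u /= /(elt_arrow_id (u := u)) ->.
  by rewrite (fmap_id (flaws (obeta F))).
- move=> F G H K t s r.
  apply: open_nat_eq => // o u /= /(elt_arrow_id (u := u)) ->.
  rewrite (fmap_id (flaws (obeta F))).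
  by rewrite (comp_id_r (claws D)) (comp_assoc (claws D)).
Qed.

(** * A pointwise criterion for invertibility *)

Section Invertible.
Variables (C D : category) (F G : open_functor C D) (theta : open_nat F G).
Variable inv : forall c, oalpha F c -> oalpha G c.
Hypothesis invK : forall c x, po (nalpha theta c) (inv x) = x.
Hypothesis Kinv : forall c (y : oalpha G c), inv (po (nalpha theta c) y) = y.
Variable g : forall o : elts (oalpha G),
  hom (obeta G o) (obeta F (elts_map (nalpha theta) o)).
Hypothesis gK : forall o, g o · nbeta theta o = idc _.
Hypothesis Kg : forall o, nbeta theta o · g o = idc _.

Lemma inv_alpha_nat (c c' : C) (f : hom c c') :
  fmap (oalpha F) f · (@inv c : @hom SetOp (oalpha G c) (oalpha F c))
    = (@inv c' : @hom SetOp (oalpha G c') (oalpha F c')) · fmap (oalpha G) f.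
Proof.
apply: functional_extensionality => x.
rewrite /= -[RHS]Kinv; congr inv.
by have /= <- := po_nat (nalpha theta) f (inv x); rewrite invK.
Qed.

Definition inv_alpha : nat_trans (oalpha G) (oalpha F) :=
  NatTrans inv_alpha_nat.

(** At (c, x), [g] lands over the point θ_α([inv] x) rather than x; the factor [elt_eq] corrects
    this. *)
Definition inv_beta_cmp (o : elts (oalpha F)) :
    hom (fcomp (obeta G) (elts_map inv_alpha) o) (obeta F o) :=
  fmap (obeta F) (elt_eq (invK (elt_pt o))) · g (elts_map inv_alpha o).

(** Inserting θ_β · [g] on the right and [g] · θ_β on the left turns this square into the naturality
    square of θ_β. *)
Lemma beta_inverse_nat (o o' : elts (oalpha G)) (u : hom o o') :
  g o' · fmap (obeta G) u
    = fmap (obeta F) (fmap (elts_map (nalpha theta)) u) · g o.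
Proof.
rewrite -[g o' · _](comp_id_r (claws D)) -(Kg o).
rewrite -[RHS](comp_id_l (claws D)) -(gK o').
rewrite !(comp_assoc (claws D)); congr (_ · _).
rewrite -!(comp_assoc (claws D)); congr (_ · _).
exact: (cmp_nat (nbeta theta) u).
Qed.

Lemma inv_beta_nat (o o' : elts (oalpha F)) (u : hom o o') :
  fmap (obeta F) u · inv_beta_cmp o
    = inv_beta_cmp o' · fmap (fcomp (obeta G) (elts_map inv_alpha)) u.
Proof.
rewrite /inv_beta_cmp -(comp_assoc (claws D)) beta_inverse_nat.
rewrite !(comp_assoc (claws D)); congr (_ · _).
rewrite -!(fmap_comp (flaws (obeta F))); congr fmap.
by apply: elt_hom_eq; rewrite /= (comp_id_l (claws C)) (comp_id_r (claws C)).
Qed.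

Lemma open_nat_iso : is_iso (C := open_hom C D) theta.
Proof.
exists (OpenNat (NatTrans inv_beta_nat)); split.
- apply: open_nat_eq => [o|o u uE]; first exact: invK.
  rewrite /= (comp_id_l (claws D)) -(comp_assoc (claws D)).
  have /= -> := gK (elts_map inv_alpha o).
  rewrite (comp_id_r (claws D)); congr fmap; exact: elt_hom_eq.
- apply: open_nat_eq => [o|o u uE]; first exact: Kinv.
  rewrite /= (comp_id_l (claws D)) (comp_assoc (claws D)).
  (* The identity is expanded as θ_β · [g] at the point [inv](θ_α(y)), so that naturality of θ_β
     along [u] can carry the right-hand side over to y. *)
  rewrite -[RHS](comp_id_r (claws D)).
  have /= <- := Kg (elts_map inv_alpha (elts_map (nalpha theta) o)).
  rewrite (comp_assoc (claws D)).
  have /= -> := cmp_nat (nbeta theta) u; congr (_ · _ · _).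
  congr fmap; exact: elt_hom_eq.
Qed.

End Invertible.

(** * Functoriality of horizontal composition *)

Lemma hcomp_id (C D E : category) (G : open_functor D E)
    (F : open_functor C D) :
  hcomp (onat_id G) (onat_id F) = onat_id (ocomp G F).
Proof.
apply: open_nat_eq => [[c [x y]]|[c [x y]] u /= uE] /=.
  rewrite /hcomp_alpha_cmp /po /=; congr existT.
  exact: (po_fmap_id y).
rewrite /hcomp_beta_cmp /arr_cmp /= (comp_id_r (claws E)) (comp_id_l (claws E)).
congr fmap; apply: elt_hom_eq => /=.
rewrite -(fmap_id (flaws (obeta F))); congr fmap.
exact: elt_hom_eq.
Qed.

(** One side transports y along e · t in a single step before applying ψ_α; the other transports
    along e, applies ψ_α, then transports along t. Naturality of ψ_α identifies the points reached,
    and naturality of φ_β and ψ_β along suitable arrows does the rest. *)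
Lemma hcomp_comp (C D E : category) (G G' G'' : open_functor D E)
    (F F' F'' : open_functor C D)
    (psi : open_nat G' G'') (phi : open_nat G G')
    (eta : open_nat F' F'') (theta : open_nat F F') :
  hcomp (onat_comp psi phi) (onat_comp eta theta)
    = onat_comp (hcomp psi eta) (hcomp phi theta).
Proof.
apply: open_nat_eq => [[c [x y]]|[c [x y]] u uE].
  rewrite /po /= /hcomp_alpha_cmp /po /=; congr existT.
  rewrite /arr_cmp /=.
  set e := nbeta eta _.
  set t := nbeta theta _.
  have := po_fmap_comp (P := oalpha G'') e t; rewrite /po /= => ->.
  congr (nalpha phi _ _).
  by have := po_nat (nalpha psi) t; rewrite /po /= => ->.
rewrite /= /hcomp_beta_cmp /arr_cmp /=.
set e := nbeta eta (Elt (oalpha F'') c x).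
set t := nbeta theta (Elt (oalpha F') c _).
have psiP : po (nalpha psi _) (po (fmap (oalpha G'') (e · t)) y)
    = po (fmap (oalpha G') t)
        (po (nalpha psi _) (po (fmap (oalpha G'') e) y)).
  by rewrite po_nat po_fmap_comp.
(* This is the arrow (t, e^*(y)), with its source written as the transport of y along e · t; ψ_β is
   moved along [w] and φ_β along [k]. *)
pose w : @hom (elts (oalpha G''))
    (Elt _ _ (po (fmap (oalpha G'') (e · t)) y))
    (Elt _ _ (po (fmap (oalpha G'') e) y)) :=
  exist _ t (eq_sym (po_fmap_comp e t y)).
pose k := elt_eq (P := oalpha G') psiP.
have -> : ocomp_snd_arr u = fmap (elts_map (nalpha phi)) k.
  apply: elt_hom_eq => /=; rewrite -(fmap_id (flaws (obeta F))); congr fmap.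
  exact: elt_hom_eq.
rewrite -!(comp_assoc (claws E)).
have /= <- := cmp_nat (nbeta phi) k.
rewrite [fmap (obeta G') _ · _](comp_assoc (claws E)).
rewrite -(fmap_comp (flaws (obeta G'))).
have -> : earr t (po (nalpha psi _) (po (fmap (oalpha G'') e) y)) · k
    = fmap (elts_map (nalpha psi)) w.
  by apply: elt_hom_eq; rewrite /= (comp_id_r (claws D)).
rewrite [X in _ = _ · X](comp_assoc (claws E)).
have /= <- := cmp_nat (nbeta psi) w.
rewrite !(comp_assoc (claws E)) -(fmap_comp (flaws (obeta G''))).
congr (fmap _ _ · _ · _); exact: elt_hom_eq.
Qed.

(** * Unitors *)

Lemma lu_natural (C D : category) (F F' : open_functor C D)
    (theta : open_nat F F') :
  onat_comp theta (lu F) = onat_comp (lu F') (hcomp (onat_id (oid D)) theta).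
Proof.
apply: open_nat_eq => // -[c x] u uE.
rewrite (elt_arrow_id (u := u)) // (fmap_id (flaws (obeta _))) /=.
rewrite /hcomp_beta_cmp /arr_cmp /=.
by rewrite !(comp_id_r (claws D)) (comp_id_l (claws D)).
Qed.

Lemma lu_iso (C D : category) (F : open_functor C D) :
  is_iso (C := open_hom C D) (lu F).
Proof.
apply: (@open_nat_iso _ _ _ _ (lu F) (fun c => @projT1 _ _) _ _
          (fun o => idc _)) => //.
- by move=> c [x []].
- by move=> o; apply: (comp_id_l (claws D)).
- by move=> o; apply: (comp_id_l (claws D)).
Qed.

Lemma ru_natural (C D : category) (F F' : open_functor C D)
    (theta : open_nat F F') :
  onat_comp theta (ru F) = onat_comp (ru F') (hcomp theta (onat_id (oid C))).
Proof.
apply: open_nat_eq => [[c x]|[c x] u uE].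
  rewrite /= /po /= /hcomp_alpha_cmp /po /=; congr existT.
  by rewrite /arr_cmp (fmap_id (flaws _)).
rewrite /= /hcomp_beta_cmp /arr_cmp /= (comp_id_l (claws D)).
(* The source of [k] is the action of an identity on x, equal to x only by functoriality of the α
   part, so θ_β is moved along [k]. *)
pose k := earr (idc c) x; rewrite -/k.
have /= -> := cmp_nat (nbeta theta) k.
rewrite -(comp_assoc (claws D)); congr (_ · _).
rewrite -(fmap_comp (flaws (obeta F))) -(fmap_id (flaws (obeta F))).
congr fmap; apply: elt_hom_eq; rewrite /= (comp_id_l (claws C)).
by rewrite uE.
Qed.

Lemma ru_iso (C D : category) (F : open_functor C D) :
  is_iso (C := open_hom C D) (ru F).
Proof.
apply: (@open_nat_iso _ _ _ _ (ru F) (fun c => @projT2 _ _) _ _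
          (fun o => idc _)) => //.
- by move=> c [[] x].
- by move=> o; apply: (comp_id_l (claws D)).
- by move=> o; apply: (comp_id_l (claws D)).
Qed.

(** * Associators *)

Lemma assoc_iso (A B C D : category) (F : open_functor A B)
    (G : open_functor B C) (H : open_functor C D) :
  is_iso (C := open_hom A D) (assoc F G H).
Proof.
apply: (@open_nat_iso _ _ _ _ (assoc F G H)
          (fun a w => existT _ (projT1 (projT1 w))
                        (existT _ (projT2 (projT1 w)) (projT2 w)))
          _ _ (fun o => idc _)) => //.
- by move=> a [[]].
- by move=> a [x []].
- by move=> o; apply: (comp_id_l (claws D)).
- by move=> o; apply: (comp_id_l (claws D)).
Qed.

Lemma assoc_natural (A B C D : category) (F F' : open_functor A B)
    (G G' : open_functor B C) (H H' : open_functor C D)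
    (theta : open_nat F F') (phi : open_nat G G') (psi : open_nat H H') :
  onat_comp (hcomp (hcomp psi phi) theta) (assoc F G H)
    = onat_comp (assoc F' G' H') (hcomp psi (hcomp phi theta)).
Proof.
apply: open_nat_eq => [[a [x [y z]]]|[a [x [y z]]] u uE].
  rewrite /po /= /hcomp_alpha_cmp /as_alpha_cmp /po /=; congr existT.
  rewrite /arr_cmp /= /hcomp_alpha_cmp /= /arr_cmp /=; congr (nalpha psi _ _).
  exact: (eq_sym (po_fmap_comp _ _ z)).
rewrite /= /hcomp_beta_cmp /arr_cmp /= /hcomp_beta_cmp /arr_cmp /=.
rewrite (comp_id_l (claws D)) (comp_id_r (claws D)).
set t := nbeta theta _.
set p := nbeta phi _.
set e := fmap (obeta G') (earr t y).
(* The left side evaluates ψ_β after transporting z along e and then p, the right side after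
   transporting along e · p; [k] joins the two points. *)
pose k := elt_eq (P := oalpha H') (eq_sym (po_fmap_comp e p z)).
have -> : ocomp_snd_arr u = fmap (elts_map (nalpha psi)) k.
  apply: elt_hom_eq => /=; rewrite -(fmap_id (flaws (obeta G))); congr fmap.
  apply: elt_hom_eq => /=; rewrite -(fmap_id (flaws (obeta F))); congr fmap.
  exact: elt_hom_eq.
rewrite -(comp_assoc (claws D)).
have /= <- := cmp_nat (nbeta psi) k.
rewrite !(comp_assoc (claws D)) -!(fmap_comp (flaws (obeta H'))).
congr (fmap _ _ · _); apply: elt_hom_eq => /=.
rewrite (comp_id_r (claws C)); congr (_ · _); congr fmap; exact: elt_hom_eq.
Qed.

(** * Coherence *)

Lemma pentagon (A B C D E : category) (F : open_functor A B)
    (G : open_functor B C) (H : open_functor C D) (I : open_functor D E) :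
  onat_comp
      (onat_comp (hcomp (assoc G H I) (onat_id F)) (assoc F (ocomp H G) I))
      (hcomp (onat_id I) (assoc F G H))
    = onat_comp (assoc F G (ocomp I H)) (assoc (ocomp G F) H I).
Proof.
apply: open_nat_eq => [[a [x [y [z w]]]]|[a [x [y [z w]]]] u uE].
  (* The left-hand side sends <x, v> to the rebracketing of <x, v'>, where v'
     is the image of v under the action of an identity arrow. *)
  pose v : oalpha (ocomp (ocomp I H) G) F@[a, x] :=
    existT _ y (existT _ z w).
  pose f (v : oalpha (ocomp (ocomp I H) G) F@[a, x]) :
      oalpha (ocomp I (ocomp H (ocomp G F))) a :=
    existT _ (existT _ (existT _ x (projT1 v)) (projT1 (projT2 v)))
      (projT2 (projT2 v)).
  rewrite -[RHS]/(f v) -[in RHS](po_fmap_id v).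
  rewrite /po /= /hcomp_alpha_cmp /as_alpha_cmp /f /po /=.
  rewrite /arr_cmp /= /as_alpha_cmp /=.
  congr existT; exact: po_fmap_id.
(* All β components involved are identities. Peeling off I_β, H_β and G_β in turn leaves an identity
   to compare with the image under F_β of an arrow over an identity. *)
rewrite /= /hcomp_beta_cmp /arr_cmp /= !(comp_id_r (claws E)).
rewrite (comp_id_l (claws E)) -(fmap_comp (flaws (obeta I))).
congr fmap; apply: elt_hom_eq; rewrite /= (comp_id_r (claws D)).
congr fmap; apply: elt_hom_eq => /=.
congr fmap; apply: elt_hom_eq => /=.
rewrite -[LHS](fmap_id (flaws (obeta F))); congr fmap.
exact: elt_hom_eq.
Qed.

Lemma triangle (B C D : category) (F : open_functor B C)
    (G : open_functor C D) :
  onat_comp (hcomp (ru G) (onat_id F)) (assoc F (oid C) G)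
    = hcomp (onat_id G) (lu F).
Proof.
apply: open_nat_eq => [[b [x y]]|[b [x y]] u uE].
  by rewrite /po /= /hcomp_alpha_cmp /as_alpha_cmp /po /=; congr existT.
rewrite /= /hcomp_beta_cmp /arr_cmp /=.
rewrite !(comp_id_r (claws D)) -(fmap_comp (flaws (obeta G))).
congr fmap; apply: elt_hom_eq => /=.
rewrite (comp_id_l (claws C)) -(fmap_id (flaws (obeta F))); congr fmap.
exact: elt_hom_eq.
Qed.

Theorem proposition22 :
  is_bicategory {|
    b0 := category;
    bhom := open_hom;
    bid := oid;
    bcomp := open_comp;
    blu := @lu;
    bru := @ru;
    bas := @assoc |}.
Proof.
split.
- exact: open_hom_laws.
- by move=> C D E; split=> *; [apply: hcomp_id | apply: hcomp_comp].
- exact: lu_iso.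
- exact: lu_natural.
- exact: ru_iso.
- exact: ru_natural.
- exact: assoc_iso.
- exact: assoc_natural.
- exact: pentagon.
- exact: triangle.
Qed.
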